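(* Let $G$ be a connected graph on $n\geq 3$ vertices with connected domination number $\gamma_c$. Then $tr(G)\leq 2\gamma_c+4$.
   Context: All graphs are finite, simple and undirected. $d(u,v)$ denotes the usual shortest-path distance. The triameter of a connected graph $G=(V,E)$ on at least $3$ vertices is $tr(G)=\max\{d(u,v)+d(v,w)+d(u,w): u,v,w\in V\}$. A dominating set is a set $D\subseteq V$ such that every vertex outside $D$ has a neighbour in $D$; the connected domination number $\gamma_c$ of $G$ is the minimum size of a nonempty dominating set $D$ whose induced subgraph is connected. *)

(* Defs.v *)
From mathcomp Require Import all_boot.

Set Implicit Arguments.
Unset Strict Implicit.
Unset Printing Implicit Defensive.

(* A finite simple undirected graph is a symmetric irreflexive [e : rel T] on
   a [T : finType]; the definitions below apply to an arbitrary relation. *)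

Section Graph.

Variables (T : finType) (e : rel T).

Definition connected_graph : bool := [forall u, forall v, connect e u v].

(* [x :: p] is a path from [x] to [y] with [k] edges; its [k.+1] vertices are
   pairwise distinct. *)
Definition path_of_length (k : nat) (x y : T) : bool :=
  [exists p : k.-tuple T, [&& path e x p, uniq (x :: p) & last x p == y]].

(* A path with distinct vertices has fewer than [#|T|] edges, so the bound on
   [k] discards nothing; the default value [#|T|] is reached only when [x] and
   [y] lie in different components. *)
Definition dist (x y : T) : nat :=
  \big[minn/#|T|]_(k < #|T| | path_of_length k x y) k.

Definition triameter : nat :=
  \max_(u : T) \max_(v : T) \max_(w : T) (dist u v + dist v w + dist u w).

Definition dominating (D : {set T}) : bool :=
  [forall x, (x \notin D) ==> [exists y, (y \in D) && e x y]].

Definition induced (D : {set T}) : rel {x : T | x \in D} :=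
  fun x y => e (val x) (val y).

End Graph.

Section ConnectedDomination.

Variables (T : finType) (e : rel T).

Definition connected_dominating (D : {set T}) : bool :=
  [&& D != set0, dominating e D & connected_graph (induced e (D := D))].

(* In a nonempty connected graph the whole vertex set is connected dominating,
   so the default value [#|T|] is a genuine candidate for the minimum. *)
Definition connected_domination_number : nat :=
  \big[minn/#|T|]_(D : {set T} | connected_dominating D) #|D|.

End ConnectedDomination.

(* Main.v *)
Require Import Defs.
From mathcomp Require Import all_boot zify.

Set Implicit Arguments.
Unset Strict Implicit.
Unset Printing Implicit Defensive.

(** Three vertices [a], [b], [c] of a connected graph on [m] vertices have
    pairwise distances summing to at most [2 * (m - 1)]: a simple path from [a]
    to [b], together with a path that leads from [c] to its first vertex [x] on
    it, forms a tree with at most [m - 1] edges, and the three routes between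
    [a], [b] and [c] inside that tree use each edge exactly twice
    ([three_dist_le]).

    Let [D] be a connected dominating set.  Each of [u], [v], [w] is within
    distance 1 of some vertex of [D], and distances in the whole graph are at
    most those in the graph induced by [D].  Moving the three vertices into [D]
    changes the sum by at most [2 * 3], since each of them occurs in two
    distances; so the sum is at most [2 * (#|D| - 1) + 6 = 2 * #|D| + 4]. *)

Section Distance.

Variables (T : finType) (e : rel T).

Lemma bigmin_le (I : finType) (P : pred I) (F : I -> nat) (m : nat) (i : I) :
  P i -> \big[minn/m]_(j | P j) F j <= F i.
Proof.
move=> Pi; have := mem_index_enum i.
elim: (index_enum I) => //= j r IHr; rewrite in_cons big_cons.
case/predU1P=> [<-|/IHr le_i]; first by rewrite Pi geq_minl.
by case: ifP => // _; rewrite geq_min le_i orbT.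
Qed.

(** Loops are removed from the walk because [dist] only measures paths without
    repeated vertices; this also keeps the length below [#|T|]. *)
Lemma dist_le_walk (x : T) (p : seq T) :
  path e x p -> dist e x (last x p) <= size p.
Proof.
move=> e_p; case/shortenP: (e_p) => q e_q q_uniq q_sub.
have q_lt : size q < #|T|.
  by have := max_card (mem (x :: q)); rewrite (card_uniqP q_uniq).
have q_le : size q <= size p.
  by apply: uniq_leq_size q_sub; case/andP: q_uniq.
apply: leq_trans q_le; rewrite /dist.
apply: (@bigmin_le _ _ (@nat_of_ord _) _ (Ordinal q_lt)).
by apply/existsP; exists (in_tuple q); rewrite e_q q_uniq eqxx.
Qed.

Lemma dist_refl (x : T) : dist e x x = 0.
Proof. by apply/eqP; rewrite -leqn0; apply: (@dist_le_walk x [::]). Qed.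

Lemma dist_edge (x y : T) : e x y -> dist e x y <= 1.
Proof. by move=> exy; apply: (@dist_le_walk x [:: y]); rewrite /= exy. Qed.

(** The minimum defining [dist] is either attained by a path or equal to the
    default [#|T|]; in the latter case any simple path between connected
    vertices is already shorter. *)
Lemma dist_walk (x y : T) : connect e x y ->
  exists p, [/\ path e x p, last x p = y & size p <= dist e x y].
Proof.
case/connectP=> p0; case/shortenP=> q e_q q_uniq _ ->{y p0}.
set y := last x q; rewrite /dist.
elim/big_ind: _ => [|m n IHm IHn|k /existsP[p /and3P[e_p _ /eqP p_last]]].
- exists q; split=> //; apply: ltnW.
  by have := max_card (mem (x :: q)); rewrite (card_uniqP q_uniq).
- by case: (leqP m n) => _.
- by exists p; split; rewrite ?size_tuple.
Qed.

Hypotheses (e_sym : symmetric e) (e_conn : connected_graph e).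

Lemma connectedT (x y : T) : connect e x y.
Proof. by move/forallP/(_ x)/forallP: e_conn. Qed.

Lemma dist_le_sym (x y : T) : dist e y x <= dist e x y.
Proof.
have [p [e_p <- /(leq_trans _)-> //]] := dist_walk (connectedT x y).
have := @dist_le_walk (last x p) (rev (belast x p)).
rewrite rev_path (eq_path (e' := e)) => [/(_ e_p)|a b]; last by rewrite e_sym.
rewrite size_rev size_belast; case: p e_p => //= z p _.
by rewrite rev_cons last_rcons.
Qed.

Lemma dist_sym (x y : T) : dist e x y = dist e y x.
Proof. by apply/eqP; rewrite eqn_leq !dist_le_sym. Qed.

Lemma dist_triangle (y x z : T) : dist e x z <= dist e x y + dist e y z.
Proof.
have [p [e_p p_last p_le]] := dist_walk (connectedT x y).
have [q [e_q q_last q_le]] := dist_walk (connectedT y z).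
have := @dist_le_walk x (p ++ q).
rewrite cat_path last_cat p_last q_last size_cat e_p => /(_ e_q) le_pq.
exact: leq_trans le_pq (leq_add p_le q_le).
Qed.

(** Follow a path from [c] only until it first meets the simple path [a :: p]:
    its vertices before that point are off [a :: p], which is where the
    cardinal of [T] enters. *)
Lemma dist_to_path (c a : T) (p : seq T) : uniq (a :: p) ->
  exists2 x, x \in a :: p & dist e c x + size p < #|T|.
Proof.
move=> p_uniq; case c_p: (c \in a :: p).
  exists c => //; rewrite dist_refl.
  by have := max_card (mem (a :: p)); rewrite (card_uniqP p_uniq).
have /connectP[q0] := connectedT c a.
case/shortenP=> q e_q q_uniq _ a_last {q0}.
have q_meets : has (mem (a :: p)) q.
  apply/hasP; exists a; last exact: mem_head.
  have: a \in c :: q by rewrite a_last mem_last.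
  rewrite in_cons => /predU1P[a_c|//].
  by rewrite -a_c mem_head in c_p.
move: e_q q_uniq {a_last}.
case/split_find: q_meets => x s1 s2 x_p s1_off.
rewrite cat_path => /andP[e_s1 _] q_uniq.
exists x => //.
have tree_uniq : uniq ((c :: s1) ++ a :: p).
  rewrite cat_uniq p_uniq andbT; apply/andP; split.
    by move: q_uniq; rewrite -cats1 -catA -cat_cons cat_uniq => /and3P[].
  by rewrite has_sym /= [c \in _]c_p.
have := dist_le_walk e_s1; rewrite last_rcons size_rcons => le_s1.
have := max_card (mem ((c :: s1) ++ a :: p)).
rewrite (card_uniqP tree_uniq) size_cat /=; lia.
Qed.

Lemma dist_through (a x : T) (p : seq T) : path e a p -> x \in a :: p ->
  dist e a x + dist e x (last a p) <= size p.
Proof.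
move=> e_p x_p; case/splitPl: x_p e_p => p1 p2 <-.
rewrite cat_path => /andP[/dist_le_walk le1 /dist_le_walk le2].
by rewrite last_cat size_cat leq_add.
Qed.

(** The vertex [x] where the path from [c] joins the path from [a] to [b] is
    the centre of the tree: each distance is bounded by going through it. *)
Lemma three_dist_le (a b c : T) :
  dist e a b + dist e b c + dist e a c <= 2 * #|T|.-1.
Proof.
have /connectP[p0] := connectedT a b.
case/shortenP=> p e_p p_uniq _ b_last {p0}.
have [x x_p x_le] := dist_to_path c p_uniq.
have le_axb := dist_through e_p x_p; rewrite -b_last in le_axb.
have le_ab := dist_triangle x a b.
have le_ac := dist_triangle x a c.
have le_bc := dist_triangle x b c.
rewrite (dist_sym x c) in le_ac le_bc.
rewrite (dist_sym b x) in le_bc.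
lia.
Qed.

End Distance.

Section Domination.

Variables (T : finType) (e : rel T).

Lemma dist_induced (D : {set T}) (x y : {x : T | x \in D}) :
  connected_graph (induced e (D := D)) ->
  dist e (val x) (val y) <= dist (induced e (D := D)) x y.
Proof.
move=> D_conn; have [p [e_p <-]] := dist_walk (connectedT D_conn x y).
apply: leq_trans; rewrite -last_map -(size_map val).
by apply: dist_le_walk; rewrite path_map.
Qed.

Lemma dominating_dist (D : {set T}) (x : T) : dominating e D ->
  exists y : {x : T | x \in D}, dist e x (val y) <= 1.
Proof.
move=> /forallP/(_ x); case: (boolP (x \in D)) => [xD _|_ /existsP[y]].
  by exists (Sub x xD); rewrite SubK dist_refl.
by case/andP=> yD exy; exists (Sub y yD); rewrite SubK dist_edge.
Qed.

Hypotheses (e_sym : symmetric e) (e_conn : connected_graph e).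

Lemma dist_via (x x' y y' : T) : dist e x x' <= 1 -> dist e y y' <= 1 ->
  dist e x y <= dist e x' y' + 2.
Proof.
move=> le_x; rewrite (dist_sym e_sym e_conn) => le_y.
have := dist_triangle e_conn x' x y; have := dist_triangle e_conn y' x' y.
lia.
Qed.

Lemma three_dist_le_dominating (D : {set T}) (u v w : T) :
  connected_dominating e D ->
  dist e u v + dist e v w + dist e u w <= 2 * #|D| + 4.
Proof.
case/and3P=> D_neq0 D_dom D_conn.
have [u' le_u] := dominating_dist u D_dom.
have [v' le_v] := dominating_dist v D_dom.
have [w' le_w] := dominating_dist w D_dom.
have D_sym : symmetric (induced e (D := D)) by move=> x y; apply: e_sym.
have := three_dist_le D_sym D_conn u' v' w'; rewrite card_sig.
have -> : #|[pred x in D]| = #|D| by apply: eq_card.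
have := dist_induced u' v' D_conn; have := dist_induced v' w' D_conn.
have := dist_induced u' w' D_conn.
have := dist_via le_u le_v; have := dist_via le_v le_w.
have := dist_via le_u le_w; rewrite -card_gt0 in D_neq0.
lia.
Qed.

End Domination.

Theorem corollary3p5 (T : finType) (e : rel T)
  (e_sym : symmetric e) (e_irr : irreflexive e)
  (e_conn : connected_graph e) (T_ge3 : 3 <= #|T|) :
  triameter e <= 2 * connected_domination_number e + 4.
Proof.
apply/bigmax_leqP => u _; apply/bigmax_leqP => v _; apply/bigmax_leqP => w _.
rewrite /connected_domination_number.
elim/big_ind: _ => [|m n IHm IHn|D]; last exact: three_dist_le_dominating.
(* The default value of the minimum is covered by the bound for the whole
   graph. *)
- have := three_dist_le e_sym e_conn u v w; lia.
- by case: (leqP m n).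
Qed.
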